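(* Let $G, N$ be natural numbers with $2G-2+N>0$ and let $K\ge 2$ be an integer. For every stable graph $\Gamma$ of type $(G,N)$ with exactly $K$ vertices, the set $\mathcal{M}$ of matrices generated by the algorithm contains a matrix $X$ whose associated stable graph is isomorphic to $\Gamma$. That is, the algorithm generates at least one graph for every isomorphism class of stable graphs of type $(G,N)$.
   Context: Natural numbers include $0$. For $K\ge 1$ write $\underline{K}=\{0,\dots,K-1\}$. **Stable graphs.** An undirected multigraph is a pair $(V,E)$ with $V$ a finite set of vertices and $E$ a finite multiset of unordered pairs of (possibly equal) vertices. $\operatorname{mult}(v,w)$ is the multiplicity of the edge $(v,w)$, $|E|$ is the cardinality of $E$ as a multiset, and $\deg v = 2\operatorname{mult}(v,v)+\sum_{w\ne v}\operatorname{mult}(v,w)$. A stable graph of type $(G,N)$ is an undirected multigraph $(V,E)$ together with a pair of natural numbers $(g_v,n_v)$ (genus and number of marked points) for each vertex $v$, such that: - the graph is connected; - $\sum_{v\in V} g_v+|E|-(|V|-1)=G$; - $\sum_{v\in V} n_v=N$; - $\deg v+n_v\ge 3$ for every vertex $v$ with $g_v=0$. Two stable graphs $(V,E,g,n)$ and $(V',E',g',n')$ are isomorphic if there is a bijection $f:V\to V'$ with $\operatorname{mult}(v,w)=\operatorname{mult}(f(v),f(w))$ for all $v,w\in V$, and $g_v=g'_{f(v)}$, $n_v=n'_{f(v)}$ for all $v\in V$. **Matrix encoding.** A stable graph with vertex set $\underline{K}$ is encoded by a $(K+3)\times K$ matrix $X=(g,n,l,a)$. Its first three rows are the vectors $g=(g_j)$,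 $n=(n_j)$, $l=(l_j)$, where $l_j=\operatorname{mult}(j,j)$ is the number of loops at $j$. Its last $K$ rows are the symmetric matrix $a=(a_{i,j})_{i,j\in\underline{K}}$ with $a_{i,j}=\operatorname{mult}(i,j)$ for $i\ne j$; the diagonal entries of $a$ are already recorded in $l$ and are disregarded in this block. $\mathcal{A}$ is the set of all such matrices coming from stable graphs of type $(G,N)$ with vertex set $\underline{K}$. **The algorithm.** The algorithm generates exactly those matrices in $\mathcal{A}$ whose columns are ordered (weakly increasing from each column to the next, comparing adjacent columns $j-1,j$ lexicographically from top to bottom while ignoring the rows of $a$ with index $j-1$ and $j$). Explicitly, $\mathcal{M}\subset\mathcal{A}$ is the set of $X=(g,n,l,a)\in\mathcal{A}$ such that for all $0<j<K$ and all $i\in\underline{K}\setminus\{j-1,j\}$ (the first three conditions not involving $i$ and being required for all $0<j<K$): - $g_{j-1}>g_j$ does not happen; - $n_{j-1}>n_j \Rightarrow g_{j-1}<g_j$; - $l_{j-1}>l_j \Rightarrow g_{j-1}<g_j$ or $n_{j-1}<n_j$; - $a_{i,j-1}>a_{i,j}\Rightarrow g_{j-1}<g_j$ or $n_{j-1}<n_j$ or $l_{j-1}<l_j$ or there is $i'<i$ with $i'\in\underline{K}\setminus\{j-1,j\}$ and $a_{i',j-1}<a_{i',j}$. *)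

(* Defs.v *)
From mathcomp Require Import all_boot all_order all_algebra.
From mathcomp Require Import finmap multiset.

Set Implicit Arguments.
Unset Strict Implicit.
Unset Printing Implicit Defensive.

Local Open Scope mset_scope.
Local Open Scope nat_scope.

(* Possibly degenerate unordered pairs {v, w}: sets with one or two elements. *)
Definition upair (V : finType) := {A : {set V} | 0 < #|A| <= 2}.

Lemma upair_subproof (V : finType) (v w : V) : 0 < #|[set v; w]| <= 2.
Proof. by rewrite cards2; case: (v != w). Qed.

Definition mk_upair (V : finType) (v w : V) : upair V :=
  exist _ [set v; w] (upair_subproof v w).

Section Multigraph.

Variables (V : finType) (E : {mset upair V}).

Definition emult (v w : V) : nat := E (mk_upair v w).

Definition edeg (v : V) : nat :=
  2 * emult v v + \sum_(w | w != v) emult v w.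

Definition eadj : rel V := fun v w => 0 < emult v w.

Definition econnected : Prop := 0 < #|V| /\ forall v w, connect eadj v w.

End Multigraph.

(* The genus formula is stated in int, so that no subtraction is truncated. *)
Record stable_graph (G N : nat) (V : finType) := StableGraph {
  edges : {mset upair V};
  genus : V -> nat;
  marks : V -> nat;
  sg_connected : econnected edges;
  sg_genus :
    ((\sum_v genus v)%:Z + (size edges)%:Z - (#|V|%:Z - 1) = G%:Z)%R;
  sg_marks : \sum_v marks v = N;
  sg_stable : forall v, genus v = 0 -> 3 <= edeg edges v + marks v
}.

Definition mult (G N : nat) (V : finType) (Gam : stable_graph G N V) :
  V -> V -> nat := emult (edges Gam).

Definition sg_iso (G N : nat) (V V' : finType)
    (Gam : stable_graph G N V) (Gam' : stable_graph G N V') : Prop :=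
  exists f : V -> V',
    [/\ bijective f,
        forall v w, mult Gam v w = mult Gam' (f v) (f w),
        forall v, genus Gam v = genus Gam' (f v)
      & forall v, marks Gam v = marks Gam' (f v)].

Section Encoding.

Variable K : nat.

Definition row_g (X : 'M[nat]_(3 + K, K)) (j : 'I_K) : nat :=
  usubmx X (@Ordinal 3 0 isT) j.
Definition row_n (X : 'M[nat]_(3 + K, K)) (j : 'I_K) : nat :=
  usubmx X (@Ordinal 3 1 isT) j.
Definition row_l (X : 'M[nat]_(3 + K, K)) (j : 'I_K) : nat :=
  usubmx X (@Ordinal 3 2 isT) j.
Definition block_a (X : 'M[nat]_(3 + K, K)) (i j : 'I_K) : nat :=
  dsubmx X i j.

(* The diagonal of the block a carries no information (loops are recorded in
   the row l); it is set to 0, so that a graph has exactly one encoding. *)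
Definition encode (G N : nat) (Gam : stable_graph G N 'I_K) :
    'M[nat]_(3 + K, K) :=
  let g := (\row_j genus Gam j)%R in
  let n := (\row_j marks Gam j)%R in
  let l := (\row_j mult Gam j j)%R in
  let a := (\matrix_(i, j) (if i == j then 0%N else mult Gam i j))%R in
  col_mx (col_mx g (col_mx n l)) a.

Definition setA (G N : nat) (X : 'M[nat]_(3 + K, K)) : Prop :=
  exists Gam : stable_graph G N 'I_K, encode Gam = X.

(* Here j' stands for the index j - 1. *)
Definition columns_ordered (X : 'M[nat]_(3 + K, K)) : Prop :=
  let g := row_g X in
  let n := row_n X in
  let l := row_l X in
  let a := block_a X in
  forall j' j : 'I_K, j = j'.+1 :> nat ->
    [/\ ~ (g j' > g j),
        n j' > n j -> g j' < g j,
        l j' > l j -> g j' < g j \/ n j' < n j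
      & forall i : 'I_K, i != j' -> i != j -> a i j' > a i j ->
          [\/ g j' < g j, n j' < n j, l j' < l j
            | exists i' : 'I_K,
                [/\ i' < i, i' != j', i' != j & a i' j' < a i' j]]].

Definition setM (G N : nat) (X : 'M[nat]_(3 + K, K)) : Prop :=
  setA G N X /\ columns_ordered X.

End Encoding.

(* Main.v *)
Require Import Defs.
From mathcomp Require Import all_boot all_order all_algebra.
From mathcomp Require Import perm zify finmap multiset.

(** Among all numberings of the vertices of the graph by [0, ..., K - 1], choose
    one whose encoding is lexicographically least when the matrix is read row by
    row, top to bottom and left to right. There are finitely many numberings, so
    such a minimum exists, and its encoding has ordered columns.

    Indeed, suppose that the columns [p] and [q = p + 1] are not in order: at the
    first row [r], outside the rows of the block [a] with index [p] and [q],
    where they differ, the entry in column [p] is the larger one. Exchange the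
    numbers of the vertices [p] and [q]; this exchanges the columns [p], [q] of
    the whole matrix and the rows [p], [q] of the block [a]. Two cases arise.
    - If [r] is above the row [p] of the block, the rows above [r] do not change,
      and row [r] first changes in column [p], where the entry decreases.
    - If [r] is the row of the block with index [i > q], the rows above row [p] of
      the block do not change. By symmetry of the block, row [p] now reads what
      column [q] read, which agrees with column [p] up to index [i] and is
      smaller at [i]. In positions [p] and [q] nothing changes because the
      diagonal of the block vanishes and the entry [(p, q)] is symmetric.
    Either way the matrix becomes strictly smaller, against minimality
    ([columns_le_at_first_difference]).

    What remains is that renumbering the vertices gives a stable graph again
    ([transport]), that it acts on encodings by [relabel], and that the four
    clauses of [columns_ordered] unfold this single lexicographic comparison
    ([columns_ordered_of_lexicographic]). *)

Set Implicit Arguments.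
Unset Strict Implicit.
Unset Printing Implicit Defensive.

Import Order.TTheory.

Local Open Scope mset_scope.
Local Open Scope nat_scope.

(** * Reading a matrix row by row *)

Section RowMajor.

Variables m n : nat.

Definition rowmajor (X : 'M[nat]_(m, n)) : m.-tuplelexi (n.-tuplelexi nat) :=
  [tuple ([tuple X i j | j < n] : n.-tuplelexi nat) | i < m].

Lemma rowmajor_lt (X Y : 'M[nat]_(m, n)) (r : 'I_m) (c : 'I_n) :
    (forall i : 'I_m, i < r -> forall j, X i j = Y i j) ->
    (forall j : 'I_n, j < c -> X r j = Y r j) ->
  X r c < Y r c -> (rowmajor X < rowmajor Y)%O.
Proof.
move=> eq_above eq_left lt_rc; apply/ltxi_tuplePlt; exists r.
  by move=> i lt_ir; rewrite !tnth_mktuple; apply: eq_mktuple => j;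
    apply: eq_above.
rewrite !tnth_mktuple; apply/ltxi_tuplePlt; exists c.
  by move=> j lt_jc; rewrite !tnth_mktuple eq_left.
by rewrite !tnth_mktuple ltEnat.
Qed.

End RowMajor.

(** * Exchanging two adjacent vertices of a minimal matrix *)

Section Relabel.

Variables m K : nat.
Implicit Types (X : 'M[nat]_(m + K, K)) (s : 'S_K).

(** The effect of a renumbering of the vertices on an encoding: the upper block
    holds vertex labels, the lower block an adjacency matrix. *)
Definition relabel s X : 'M[nat]_(m + K, K) :=
  col_mx (col_perm s (usubmx X)) (row_perm s (col_perm s (dsubmx X))).

Lemma relabelEu s X i j : relabel s X (lshift K i) j = X (lshift K i) (s j).
Proof. by rewrite /relabel col_mxEu !mxE. Qed.

Lemma relabelEd s X i j :
  relabel s X (rshift m i) j = X (rshift m (s i)) (s j).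
Proof. by rewrite /relabel col_mxEd !mxE. Qed.

(** Otherwise exchanging [p] and [q] would make the matrix smaller: the first
    entry that changes is [(r, p)] when [r] is above the row [p] of the lower
    block, and the mirror image of [r] in that row when [r] is below. *)
Lemma columns_le_at_first_difference X (p q : 'I_K) (r : 'I_(m + K)) :
    q = p.+1 :> nat ->
    (forall i j, dsubmx X i j = dsubmx X j i) ->
    dsubmx X p p = dsubmx X q q ->
    (rowmajor X <= rowmajor (relabel (tperm p q) X))%O ->
    r != rshift m p -> r != rshift m q ->
    (forall r' : 'I_(m + K), r' < r -> r' != rshift m p -> r' != rshift m q ->
      X r' p = X r' q) ->
  X r p <= X r q.
Proof.
move=> Eq symX diagX minX rp rq eqX; rewrite leqNgt; apply/negP => gtX.
move: minX; rewrite leNgt => /negP; apply.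
have rowE (r' : 'I_(m + K)) k : r' != rshift m p -> r' != rshift m q ->
    relabel (tperm p q) X r' k = X r' (tperm p q k).
  case: (split_ordP r') => i -> ip iq; first exact: relabelEu.
  rewrite relabelEd [tperm p q i]tpermD //.
    by rewrite eq_sym; move: ip; rewrite (inj_eq (@rshift_inj _ _)).
  by rewrite eq_sym; move: iq; rewrite (inj_eq (@rshift_inj _ _)).
(* A row above [r] other than the two ignored ones has equal entries in the
   columns [p] and [q], so the exchange does not affect it. *)
have rowK (r' : 'I_(m + K)) k : r' < r -> r' != rshift m p -> r' != rshift m q ->
    relabel (tperm p q) X r' k = X r' k.
  by move=> lt_r' r'p r'q; rewrite rowE //; case: tpermP => // ->; rewrite eqX.
have [lt_rp|le_pr] := ltnP r (rshift m p).
  apply: (@rowmajor_lt _ _ _ _ r p) => [i lt_ir j|j lt_jp|].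
  - by apply: rowK => //; rewrite -val_eqE /= neq_ltn; move: lt_rp => /=; lia.
  - by rewrite rowE // tpermD // -val_eqE /=; lia.
  - by rewrite rowE // tpermL.
case: (split_ordP r) rp rq eqX gtX rowK le_pr => i -> rp rq eqX gtX rowK le_pr.
  by move: le_pr => /=; have := ltn_ord i; lia.
have lt_qi : q < i.
  by move: rp rq le_pr; rewrite -!val_eqE /=; lia.
(* Row [r] lies below row [p] of the lower block, so the first change is seen
   in row [p], at the column [i] that mirrors [r]. *)
apply: (@rowmajor_lt _ _ _ _ (rshift m p) i) => [r' lt_r'p j|j lt_ji|].
- by apply: rowK; rewrite -?val_eqE; move: lt_r'p => /=; lia.
- rewrite relabelEd tpermL; case: tpermP => [->|->|/eqP jp /eqP jq].
  + by move: diagX; rewrite !mxE.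
  + by move: (symX p q); rewrite !mxE.
  + move: (symX p j) (symX q j); rewrite !mxE => -> ->; rewrite eqX //=.
    * by rewrite ltn_add2l.
    * by rewrite (inj_eq (@rshift_inj _ _)).
    * by rewrite (inj_eq (@rshift_inj _ _)).
- rewrite relabelEd tpermL tpermD -?val_eqE /=; try lia.
  by move: (symX p i) (symX q i); rewrite !mxE => -> ->.
Qed.

(** The form in which the ordering is used: a descent from column [p] to column
    [q] is preceded by an ascent. The least row where the two columns differ is
    such an ascent, because it cannot be a descent. *)
Lemma columns_lexicographic X (p q : 'I_K) (r : 'I_(m + K)) :
    q = p.+1 :> nat ->
    (forall i j, dsubmx X i j = dsubmx X j i) ->
    dsubmx X p p = dsubmx X q q ->
    (rowmajor X <= rowmajor (relabel (tperm p q) X))%O ->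
    r != rshift m p -> r != rshift m q -> X r q < X r p ->
  exists r' : 'I_(m + K),
    [/\ r' < r, r' != rshift m p, r' != rshift m q & X r' p < X r' q].
Proof.
move=> Eq symX diagX minX rp rq gtX.
(* The ignored rows never count as a difference. *)
pose differs (r' : 'I_(m + K)) :=
  [&& r' != rshift m p, r' != rshift m q & X r' p != X r' q].
have differs_r : differs r by rewrite /differs rp rq neq_ltn gtX orbT.
case: (arg_minnP (fun r' : 'I_(m + K) => r' : nat) differs_r).
move=> r0 /and3P[r0p r0q ne_r0] min_r0.
have le_r0 : X r0 p <= X r0 q.
  apply: columns_le_at_first_difference => // r' lt_r' r'p r'q.
  apply/eqP; apply: contraLR lt_r' => ne_r'; rewrite -leqNgt.
  by apply: min_r0; rewrite /differs r'p r'q.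
exists r0; split=> //; last by rewrite ltn_neqAle ne_r0.
rewrite ltn_neqAle min_r0 // andbT val_eqE.
by apply: contraTneq gtX => <-; rewrite -leqNgt.
Qed.

End Relabel.

(** * Images of edge multisets *)

Section PushMultigraph.

Variables (V W : finType) (f : V -> W).

Lemma push_upair_subproof (A : upair V) : 0 < #|f @: val A| <= 2.
Proof.
case: A => A /= /andP[A_gt0 A_le2].
rewrite (leq_trans (leq_imset_card _ _) A_le2) andbT lt0n cards_eq0.
by rewrite imset_eq0 -cards_eq0 -lt0n.
Qed.

Definition push_upair (A : upair V) : upair W :=
  exist _ (f @: val A) (push_upair_subproof A).

Lemma push_mk_upair v w : push_upair (mk_upair v w) = mk_upair (f v) (f w).
Proof. by apply: val_inj; rewrite /= imsetU1 imset_set1. Qed.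

(** Listing the images keeps multiplicities even where [push_upair] identifies
    pairs, so the number of edges is preserved for every [f]. *)
Definition push_edges (E : {mset upair V}) : {mset upair W} :=
  seq_mset (map push_upair E).

Lemma size_push_edges E : size (push_edges E) = size E.
Proof. by rewrite (perm_size (perm_eq_seq_mset _)) size_map. Qed.

Lemma emult_push_edges E v w :
  injective f -> emult (push_edges E) (f v) (f w) = emult E v w.
Proof.
move=> f_inj; rewrite /emult /push_edges mset_seqE -push_mk_upair count_map.
rewrite -count_mem_mset; apply: eq_count => A /=.
apply/eqP/eqP => [eqA|-> //]; apply: val_inj.
exact: (imset_inj f_inj (congr1 val eqA)).
Qed.

End PushMultigraph.

Lemma emultC (V : finType) (E : {mset upair V}) v w : emult E v w = emult E w v.
Proof.
by congr (E _); apply: val_inj; rewrite /= setUC.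
Qed.

(** * Stable graphs along a bijection of vertices *)

Section Transport.

Variables (G N : nat) (V W : finType) (Gam : stable_graph G N V).
Variables (f : V -> W) (h : W -> V).
Hypotheses (fK : cancel f h) (hK : cancel h f).

Let E := push_edges f (edges Gam).

Let emultE v w : emult E v w = mult Gam (h v) (h w).
Proof. by rewrite -{1}(hK v) -{1}(hK w) emult_push_edges //; apply: can_inj fK. Qed.

Let h_bij : bijective h. Proof. by exists f. Qed.

Let card_eq : #|V| = #|W|.
Proof. by apply: bij_eq_card; exists h. Qed.

Let connectedE : econnected E.
Proof.
case: (sg_connected Gam) => V_gt0 connV; split; first by rewrite -card_eq.
move=> v w; have /connectP[p path_p last_p] := connV (h v) (h w).
apply/connectP; exists (map f p); last by rewrite -(hK v) last_map -last_p hK.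
rewrite -(hK v); apply: homo_path path_p => x y.
by rewrite /eadj emultE !fK.
Qed.

Let genusE :
  ((\sum_v (genus Gam (h v)))%:Z + (size E)%:Z - (#|W|%:Z - 1) = G%:Z)%R.
Proof.
rewrite size_push_edges -card_eq; apply: etrans (sg_genus Gam).
by rewrite [in RHS](reindex h) //; apply: onW_bij.
Qed.

Let marksE : \sum_v marks Gam (h v) = N.
Proof.
apply: etrans (sg_marks Gam).
by rewrite [in RHS](reindex h) //; apply: onW_bij.
Qed.

Let stableE v : genus Gam (h v) = 0 -> 3 <= edeg E v + marks Gam (h v).
Proof.
move/(sg_stable (s := Gam)); congr (_ <= _ + _).
rewrite /edeg emultE; congr (_ + _).
rewrite (reindex h) /=; last exact: onW_bij.
apply: eq_big => [w|w _]; first by rewrite (can_eq hK).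
by rewrite emultE.
Qed.

(** The graph with vertices renamed by [f]. Its vertex labels and multiplicities
    are those of [Gam] read through the inverse [h], so each axiom reduces to
    that of [Gam] after reindexing by [h]. *)
Definition transport : stable_graph G N W :=
  StableGraph connectedE genusE marksE stableE.

Lemma mult_transport v w : mult transport v w = mult Gam (h v) (h w).
Proof. exact: emultE. Qed.

Lemma transport_iso : sg_iso transport Gam.
Proof. by exists h; split=> // v w; apply: mult_transport. Qed.

End Transport.

(** * Entries of an encoding and the order of its columns *)

Section EncodeEntries.

Variables (G N K : nat).
Implicit Type Gam : stable_graph G N 'I_K.

(* [encode] stacks its first three rows as blocks of height [1 + (1 + 1)]; the
   row index is rewritten in terms of the corresponding block injections. *)
Lemma row_g_encode Gam j : row_g (encode Gam) j = genus Gam j.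
Proof.
rewrite /row_g /encode col_mxKu.
have -> : Ordinal (isT : 0 < 3) = lshift (1 + 1) (ord0 : 'I_1) by apply: val_inj.
by apply: etrans (col_mxEu _ _ _ _) _; rewrite mxE.
Qed.

Lemma row_n_encode Gam j : row_n (encode Gam) j = marks Gam j.
Proof.
rewrite /row_n /encode col_mxKu.
have -> : Ordinal (isT : 1 < 3) = rshift 1 (lshift 1 (ord0 : 'I_1)).
  exact: val_inj.
by apply: etrans (col_mxEd _ _ _ _) _; rewrite col_mxEu mxE.
Qed.

Lemma row_l_encode Gam j : row_l (encode Gam) j = mult Gam j j.
Proof.
rewrite /row_l /encode col_mxKu.
have -> : Ordinal (isT : 2 < 3) = rshift 1 (rshift 1 (ord0 : 'I_1)).
  exact: val_inj.
by apply: etrans (col_mxEd _ _ _ _) _; rewrite col_mxEd mxE.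
Qed.

Lemma block_a_encode Gam i j :
  block_a (encode Gam) i j = if i == j then 0 else mult Gam i j.
Proof. by rewrite /block_a /encode col_mxKd mxE. Qed.

Lemma encodingP (X Y : 'M[nat]_(3 + K, K)) :
    row_g X =1 row_g Y -> row_n X =1 row_n Y -> row_l X =1 row_l Y ->
  block_a X =2 block_a Y -> X = Y.
Proof.
move=> eq_g eq_n eq_l eq_a; rewrite -[X]vsubmxK -[Y]vsubmxK.
congr col_mx; apply/matrixP => i j; last exact: eq_a.
case: i => [[|[|[|//]]] i_lt].
- by have := eq_g j; rewrite /row_g (bool_irrelevance isT i_lt).
- by have := eq_n j; rewrite /row_n (bool_irrelevance isT i_lt).
- by have := eq_l j; rewrite /row_l (bool_irrelevance isT i_lt).
Qed.

(** The four clauses of [columns_ordered] are one condition read off at the rows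
    [g], [n], [l] and [a]: the alternatives in the conclusion of each clause are
    the places above the descent where an ascent can occur. *)
Lemma columns_ordered_of_lexicographic (X : 'M[nat]_(3 + K, K)) :
    (forall (p q : 'I_K) (r : 'I_(3 + K)), q = p.+1 :> nat ->
      r != rshift 3 p -> r != rshift 3 q -> X r q < X r p ->
      exists r' : 'I_(3 + K),
        [/\ r' < r, r' != rshift 3 p, r' != rshift 3 q & X r' p < X r' q]) ->
  columns_ordered X.
Proof.
move=> lexX; rewrite /columns_ordered /= => p q Eq.
pose top (i : 'I_3) := lshift K i.
have topN i j : top i != rshift 3 j by rewrite eq_lrshift.
have row_gE j : row_g X j = X (top (Ordinal (isT : 0 < 3))) j by rewrite /row_g mxE.
have row_nE j : row_n X j = X (top (Ordinal (isT : 1 < 3))) j by rewrite /row_n mxE.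
have row_lE j : row_l X j = X (top (Ordinal (isT : 2 < 3))) j by rewrite /row_l mxE.
have block_aE i j : block_a X i j = X (rshift 3 i) j by rewrite /block_a mxE.
have topE (r' : 'I_3) :
    X (top r') p < X (top r') q ->
    [\/ r' = 0 :> nat /\ row_g X p < row_g X q,
        r' = 1 :> nat /\ row_n X p < row_n X q
      | r' = 2 :> nat /\ row_l X p < row_l X q].
  rewrite !row_gE !row_nE !row_lE; case: r' => [[|[|[|//]]] r_lt].
  - by rewrite (bool_irrelevance r_lt isT) => ?; constructor 1.
  - by rewrite (bool_irrelevance r_lt isT) => ?; constructor 2.
  - by rewrite (bool_irrelevance r_lt isT) => ?; constructor 3.
split=> /=.
- rewrite !row_gE => /(lexX _ _ _ Eq (topN _ _) (topN _ _)).
  by case=> r' [].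
- rewrite !row_nE => /(lexX _ _ _ Eq (topN _ _) (topN _ _)).
  case=> r'; case: (split_ordP r') => i' -> [lt_r' _ _]; last by [].
  by case/topE=> -[Ei']; rewrite /= Ei' in lt_r'.
- rewrite !row_lE => /(lexX _ _ _ Eq (topN _ _) (topN _ _)).
  case=> r'; case: (split_ordP r') => i' -> [lt_r' _ _]; last by [].
  by case/topE=> -[Ei']; rewrite /= Ei' in lt_r'; [left | right |].
- move=> i ip iq; rewrite !block_aE => /(lexX _ _ _ Eq).
  rewrite !(inj_eq (@rshift_inj _ _)) => /(_ ip iq)[r'].
  case: (split_ordP r') => i' -> [lt_r'].
    move=> _ _ /topE[] [_]; [by constructor 1|by constructor 2|by constructor 3].
  rewrite !(inj_eq (@rshift_inj _ _)) => i'p i'q lt_a; constructor 4.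
  by exists i'; rewrite !block_aE; split; rewrite -1?(ltn_add2l 3).
Qed.

End EncodeEntries.

Theorem proposition4p1 (G N K : nat)
  (hGN : (0 < 2 * G%:Z - 2 + N%:Z :> int)%R)
  (hK : 2 <= K)
  (V : finType) (Gam : stable_graph G N V) (hV : #|V| = K) :
  exists X : 'M[nat]_(3 + K, K),
    setM G N X /\
    exists GamX : stable_graph G N 'I_K, encode GamX = X /\ sg_iso GamX Gam.
Proof.
subst K; clear hGN hK.
pose number (s : 'S_#|V|) (v : V) := (s^-1)%g (enum_rank v).
pose vertex (s : 'S_#|V|) (j : 'I_#|V|) : V := enum_val (s j).
have numberK s : cancel (number s) (vertex s).
  by move=> v; rewrite /vertex /number permKV enum_rankK.
have vertexK s : cancel (vertex s) (number s).
  by move=> j; rewrite /vertex /number enum_valK permK.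
pose graph s := transport Gam (numberK s) (vertexK s).
pose code s := encode (graph s).
(* Composing permutations means applying [t] first: position [j] of the new
   matrix shows the vertex that [s] puts in position [t j]. *)
have codeM t s : code (t * s)%g = relabel t (code s).
  apply: encodingP => [j|j|j|i j].
  - rewrite row_g_encode; transitivity (row_g (code s) (t j)).
      by rewrite row_g_encode /= /vertex permM.
    by rewrite /row_g /relabel col_mxKu [in RHS]mxE.
  - rewrite row_n_encode; transitivity (row_n (code s) (t j)).
      by rewrite row_n_encode /= /vertex permM.
    by rewrite /row_n /relabel col_mxKu [in RHS]mxE.
  - rewrite row_l_encode; transitivity (row_l (code s) (t j)).
      by rewrite row_l_encode !mult_transport /vertex permM.
    by rewrite /row_l /relabel col_mxKu [in RHS]mxE.
  - rewrite block_a_encode; transitivity (block_a (code s) (t i) (t j)).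
      rewrite block_a_encode !mult_transport /vertex !permM.
      by rewrite (inj_eq perm_inj).
    by rewrite /block_a /relabel col_mxKd 2![in RHS]mxE.
have [s _ min_s] :=
  arg_minP (fun s => rowmajor (code s)) (isT : predT (1%g : 'S_#|V|)).
exists (code s); split; last by exists (graph s); split=> //; apply: transport_iso.
split; first by exists (graph s).
apply: columns_ordered_of_lexicographic => p q r Eq.
apply: columns_lexicographic => //.
- move=> i j; rewrite -!/(block_a _ _ _) !block_a_encode eq_sym.
  by case: (j == i) => //; apply: emultC.
- by rewrite -!/(block_a _ _ _) !block_a_encode !eqxx.
- by rewrite -codeM; apply: min_s.
Qed.
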